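(* Let $N$ be a squarefree positive integer and let $\Sigma=\{(t,t^2): t\in\mathbb{Z}/N\mathbb{Z}\}\subset(\mathbb{Z}/N\mathbb{Z})^2$. Then for every function $f:(\mathbb{Z}/N\mathbb{Z})^2\to\mathbb{C}$, $$\left(\frac{1}{|\Sigma|}\sum_{m\in\Sigma}|\widehat{f}(m)|^2\right)^{\frac12}\leq 2^{\frac{\omega(N)}{4}}\cdot N^{-1}\left(\sum_{x\in(\mathbb{Z}/N\mathbb{Z})^2}|f(x)|^{\frac43}\right)^{\frac34},$$ where $\omega(N)$ denotes the number of distinct prime divisors of $N$.
   Context: The Fourier transform of $f:(\mathbb{Z}/N\mathbb{Z})^2\to\mathbb{C}$ is normalized by $\widehat{f}(m)=N^{-1}\sum_{x\in(\mathbb{Z}/N\mathbb{Z})^2}f(x)e^{-2\pi i x\cdot m/N}$ for $m\in(\mathbb{Z}/N\mathbb{Z})^2$, where $x\cdot m=x_1m_1+x_2m_2$. *)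

(* Defs.v *)
From HB Require Import structures.
From mathcomp Require Import all_boot all_order all_algebra.
From mathcomp Require Import all_classical all_reals all_analysis.
From mathcomp Require Import complex.

Set Implicit Arguments.
Unset Strict Implicit.
Unset Printing Implicit Defensive.

Import Order.TTheory GRing.Theory Num.Theory.
Import Normc.

Local Open Scope ring_scope.
Local Open Scope complex_scope.

(* Z/NZ is 'I_N with the operations Zp_add, Zp_mul modulo N. Unlike 'Z_N,
   this is also correct for N = 1. *)

Definition squarefree (N : nat) : Prop :=
  forall d : nat, (d ^ 2 %| N)%N -> d = 1%N.

Definition omega (N : nat) : nat := size (primes N).

Definition parabola (N : nat) : {set 'I_N * 'I_N} :=
  [set (t, Zp_mul t t) | t : 'I_N].

Definition expi (R : realType) (theta : R) : R[i] := cos theta +i* sin theta.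

Definition dot (N : nat) (x m : 'I_N * 'I_N) : 'I_N :=
  Zp_add (Zp_mul x.1 m.1) (Zp_mul x.2 m.2).

Definition fourier (R : realType) (N : nat) (f : 'I_N * 'I_N -> R[i])
    (m : 'I_N * 'I_N) : R[i] :=
  N%:R^-1 *
  \sum_(x : 'I_N * 'I_N) f x * expi (- (2 * pi * (dot x m)%:R / N%:R)).

(* Main.v *)
(* Write F for the restriction of the Fourier transform of f to the parabola
   and g for the extension sum_t F(t) e(x . (t, t^2) / N).  Then N times
   sum |F|^2 is the pairing of f with g, which Hoelder bounds by
   ||f||_(4/3) ||g||_4.  Parseval turns ||g||_4^4 = ||g^2||_2^2 into N^2 times
   the sum over u of |sum F(s) F(t)|^2 over the pairs (s, t) with
   (s + t, s^2 + t^2) = u.  Modulo an odd prime such pairs agree up to a swap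
   and modulo 2 there are only two residues, so each u has at most
   2^omega(N) of them, and Cauchy-Schwarz concludes. *)
Require Import Defs.
From HB Require Import structures.
From mathcomp Require Import all_boot all_order all_algebra.
From mathcomp Require Import all_classical all_reals all_analysis.
From mathcomp Require Import complex ring lra.
Import Order.TTheory GRing.Theory Num.Theory.
Import Normc.
Local Open Scope ring_scope.
Local Open Scope complex_scope.

(** * Congruences modulo a squarefree number and modulo its primes *)

(** Squarefreeness makes the [p]-part of [N] equal to [p] for each prime divisor, so divisibility by
    [N] can be tested prime by prime. *)
Lemma squarefree_eqn_mod {N m n : nat} : (0 < N)%N -> squarefree N ->
  (forall p, p \in primes N -> m = n %[mod p]) -> m = n %[mod N].
Proof.
move=> N_gt0 sqfN; wlog lemn : m n / (m <= n)%N => [WL mn|mn].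
  by have [|/ltnW] := leqP m n => le; [|symmetry];
     apply: WL => // p pN; rewrite mn.
apply/esym/eqP; rewrite eqn_mod_dvd //; apply/dvdn_partP => // p pN.
have p_prime : prime p by move: pN; rewrite mem_primes; case/andP.
have -> : (N`_p = p)%N; last by rewrite -eqn_mod_dvd //; apply/eqP/esym/mn.
rewrite p_part; suff -> : logn p N = 1%N by [].
apply/eqP; rewrite eqn_leq logn_gt0 pN andbT leqNgt -pfactor_dvdn //.
by apply/negP => /sqfN p1; rewrite p1 in p_prime.
Qed.

Lemma eqn_mod_Fp {p : nat} (m n : nat) : prime p ->
  (m == n %[mod p]) = (m%:R == n%:R :> 'F_p).
Proof. by move=> pP; rewrite -val_eqE /= !val_Fp_nat. Qed.

(** Substituting [t = s0 + t0 - s] factors the difference of the two sums of squares as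
    [2 (s - s0) (s - t0)]. *)
Lemma sum_sqr_roots (D : idomainType) (s t s0 t0 : D) : 2%:R != 0 :> D ->
  s + t = s0 + t0 -> s ^+ 2 + t ^+ 2 = s0 ^+ 2 + t0 ^+ 2 ->
  (s == s0) || (s == t0).
Proof.
move=> two_neq0 sum sqr; rewrite -(subr_eq0 s s0) -(subr_eq0 s t0).
have tE : t = s0 + t0 - s by rewrite -sum addrC addKr.
have /eqP : 2%:R * ((s - s0) * (s - t0)) = 0.
  transitivity (s ^+ 2 + t ^+ 2 - (s0 ^+ 2 + t0 ^+ 2)).
    by rewrite tE; ring.
  by rewrite sqr subrr.
by rewrite !mulf_eq0 (negPf two_neq0).
Qed.

(** A single bit, agreement with [s0], determines a solution: for odd [p] the only alternative is
    [t0], and for [p = 2] the only other residue. *)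
Lemma sum_sqr_inj_mod {p s0 t0 s1 t1 s2 t2 : nat} : prime p ->
  s1 + t1 = s0 + t0 %[mod p] -> s1 ^ 2 + t1 ^ 2 = s0 ^ 2 + t0 ^ 2 %[mod p] ->
  s2 + t2 = s0 + t0 %[mod p] -> s2 ^ 2 + t2 ^ 2 = s0 ^ 2 + t0 ^ 2 %[mod p] ->
  (s1 == s0 %[mod p]) = (s2 == s0 %[mod p]) ->
  s1 = s2 %[mod p].
Proof.
move=> p_prime; have [->|p_neq2] := eqVneq p 2%N.
  by rewrite !modn2 => _ _ _ _; do 3 case: odd.
have two_neq0 : 2%:R != 0 :> 'F_p.
  by rewrite -(dvdn_pcharf (pchar_Fp p_prime)) dvdn_prime2.
have root s t : (s + t = s0 + t0 %[mod p])%N ->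
    (s ^ 2 + t ^ 2 = s0 ^ 2 + t0 ^ 2 %[mod p])%N ->
    (s == s0 %[mod p]) || (s == t0 %[mod p]).
  move=> /eqP + /eqP; rewrite !eqn_mod_Fp // !natrD !natrX => /eqP + /eqP.
  exact: sum_sqr_roots.
move=> h1 /(root _ _ h1) r1 h2 /(root _ _ h2) r2 e; move: r1 r2; rewrite -e.
by case: eqP e => [-> /esym/eqP ->|_ _ /= /eqP -> /eqP ->].
Qed.

(** * Cauchy-Schwarz and Hoelder for finite sums *)

Section SumInequalities.
Context {C : numDomainType} {I : finType}.

(** Lagrange's identity: twice the difference of the two sides is the double sum of the squares
    [(a i * b j - a j * b i) ^+ 2]. Real entries make these squares nonnegative in the partially
    ordered [C]. *)
Lemma cauchy_schwarz_sum (P : pred I) (a b : I -> C) :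
  (forall i, a i \is Num.real) -> (forall i, b i \is Num.real) ->
  (\sum_(i | P i) a i * b i) ^+ 2
    <= (\sum_(i | P i) a i ^+ 2) * (\sum_(i | P i) b i ^+ 2).
Proof.
move=> a_real b_real.
have sumM (u v : I -> C) : (\sum_(i | P i) u i) * (\sum_(i | P i) v i)
    = \sum_(i | P i) \sum_(j | P j) u i * v j by rewrite big_distrlr.
have lagrange : 0 <= \sum_(i | P i) \sum_(j | P j) (a i * b j - a j * b i) ^+ 2.
  apply: sumr_ge0 => i _; apply: sumr_ge0 => j _.
  by apply: real_exprn_even_ge0; rewrite // rpredB ?rpredM.
rewrite -subr_ge0 -(pmulrn_lge0 _ (ltn0Sn 1)).
congr (0 <= _): lagrange.
rewrite mulr2n {1}[X in _ = X - _ + _]mulrC expr2 !sumM.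
rewrite -!sumrN -!big_split /=; apply: eq_bigr => i _.
rewrite -!sumrN -!big_split /=; apply: eq_bigr => j _; ring.
Qed.

(* Hoelder's inequality for the exponents 4/3 and 4 is Cauchy-Schwarz twice:
   [sum a^3 g = sum a^2 (a g)] and [sum a^2 g^2] is again a pairing. *)
Lemma hoelder43_sum (a g : I -> C) :
  (forall i, 0 <= a i) -> (forall i, 0 <= g i) ->
  (\sum_i a i ^+ 3 * g i) ^+ 4 <= (\sum_i a i ^+ 4) ^+ 3 * \sum_i g i ^+ 4.
Proof.
move=> a_ge0 g_ge0.
have a_real i : a i \is Num.real by apply: ger0_real.
have g_real i : g i \is Num.real by apply: ger0_real.
have A_ge0 : 0 <= \sum_i a i ^+ 4 by apply: sumr_ge0 => i _; apply: exprn_ge0.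
have cs1 : (\sum_i a i ^+ 3 * g i) ^+ 2
    <= (\sum_i a i ^+ 4) * \sum_i a i ^+ 2 * g i ^+ 2.
  have := cauchy_schwarz_sum xpredT (fun i => a i ^+ 2) (fun i => a i * g i).
  under eq_bigr do rewrite mulrA -exprSr.
  under [X in _ <= X * _]eq_bigr do rewrite -exprM.
  under [X in _ <= _ * X]eq_bigr do rewrite exprMn.
  by apply=> i; rewrite ?rpredX ?rpredM.
have cs2 : (\sum_i a i ^+ 2 * g i ^+ 2) ^+ 2
    <= (\sum_i a i ^+ 4) * \sum_i g i ^+ 4.
  have := cauchy_schwarz_sum xpredT (fun i => a i ^+ 2) (fun i => g i ^+ 2).
  under [X in _ <= X * _]eq_bigr do rewrite -exprM.
  under [X in _ <= _ * X]eq_bigr do rewrite -exprM.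
  by apply=> i; rewrite ?rpredX.
have X_ge0 : 0 <= \sum_i a i ^+ 3 * g i.
  by apply: sumr_ge0 => i _; rewrite mulr_ge0 ?exprn_ge0.
have Y_ge0 : 0 <= \sum_i a i ^+ 2 * g i ^+ 2.
  by apply: sumr_ge0 => i _; rewrite mulr_ge0 ?exprn_ge0.
set Y := \sum_i a i ^+ 2 * g i ^+ 2 in cs1 cs2 Y_ge0.
rewrite (exprM _ 2 2).
apply: (@le_trans _ _ (((\sum_i a i ^+ 4) * Y) ^+ 2)).
  by rewrite lerXn2r ?nnegrE ?exprn_ge0 ?mulr_ge0.
by rewrite exprMn (exprSr _ 2) -mulrA ler_wpM2l ?exprn_ge0.
Qed.
End SumInequalities.

(** * Representations as a sum of two points of the parabola *)

(** This is the sum in the group of the two points of the parabola with parameters [p.1] and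
    [p.2]. *)
Definition sum_sqr {N : nat} (p : 'I_N * 'I_N) : 'I_N * 'I_N :=
  (Zp_add p.1 p.2, Zp_add (Zp_mul p.1 p.1) (Zp_mul p.2 p.2)).

Lemma card_sum_sqr_fibre {N : nat} (u : 'I_N * 'I_N) : (0 < N)%N ->
  squarefree N -> (#|[pred p | sum_sqr p == u]| <= 2 ^ omega N)%N.
Proof.
move=> N_gt0 sqfN.
have [q0 /eqP q0u|none] := pickP [pred p | sum_sqr p == u]; last first.
  by rewrite eq_card0.
(* An element of the fibre is determined by the set of primes modulo which its
   first coordinate agrees with that of [q0]. *)
pose code (q : 'I_N * 'I_N) :=
  [tuple of [seq q.1 == q0.1 %[mod p] | p <- in_tuple (primes N)]].
have sum_mod q : sum_sqr q = u -> q.1 + q.2 = q0.1 + q0.2 %[mod N].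
  by rewrite -q0u => -[].
have sqr_mod q : sum_sqr q = u ->
    q.1 ^ 2 + q.2 ^ 2 = q0.1 ^ 2 + q0.2 ^ 2 %[mod N].
  by rewrite -q0u => -[_]; rewrite !modnDm !mulnn.
suff code_inj : {in [pred p | sum_sqr p == u] &, injective code}.
  by have := leq_card_in _ _ code_inj; rewrite card_tuple card_bool.
move=> q q'; rewrite !inE => /eqP qu /eqP q'u /(congr1 val) /= /eq_in_map eq_code.
have eq1 : q.1 = q'.1 %[mod N].
  apply: squarefree_eqn_mod => // p pN.
  move: (pN); rewrite mem_primes => /and3P[p_prime _ p_dvd].
  have modp m n : m = n %[mod N] -> m = n %[mod p].
    by move=> mn; rewrite -(modn_dvdm m p_dvd) mn modn_dvdm.
  apply: (@sum_sqr_inj_mod _ q0.1 q0.2 _ q.2 _ q'.2) => //.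
  - exact/modp/sum_mod.
  - exact/modp/sqr_mod.
  - exact/modp/sum_mod.
  - exact/modp/sqr_mod.
  - exact: eq_code.
have e1 : q.1 = q'.1 by apply: val_inj; move: eq1; rewrite !modn_small.
have : q.1 + q.2 = q.1 + q'.2 %[mod N].
  by rewrite (sum_mod q) // e1 (sum_mod q').
move/eqP; rewrite eqn_modDl !modn_small // => /eqP /val_inj e2.
by rewrite (surjective_pairing q) e1 e2 -surjective_pairing.
Qed.

(** * Characters, Parseval and the restriction estimate over a field with a primitive root *)

Section Characters.
Variables (C : numClosedFieldType) (N : nat) (w : C).
Hypothesis wP : N.-primitive_root w.

Let N_gt0 : (0 < N)%N := prim_order_gt0 wP.
Let w_neq0 : w != 0. Proof. by rewrite (prim_root_eq0 wP) -lt0n. Qed.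

Lemma conj_prim_root (k : nat) : (w ^+ k)^*%R = w ^- k.
Proof.
have w_norm : `|w ^+ k| = 1.
  apply/eqP; rewrite -(pexpr_eq1 N_gt0) // -normrX exprAC (prim_expr_order wP).
  by rewrite expr1n normr1.
by rewrite invC_norm w_norm expr1n invr1 mul1r.
Qed.

Lemma prim_dotE (x m : 'I_N * 'I_N) :
  w ^+ dot x m = w ^+ (x.1 * m.1 + x.2 * m.2).
Proof. by rewrite (prim_expr_mod wP) exprD !(prim_expr_mod wP) -exprD. Qed.

(** This multiplicativity lets the square of an extension be grouped by the fibres of [sum_sqr]. *)
Lemma prim_dot_sum_sqr (x p : 'I_N * 'I_N) :
  w ^+ dot x (sum_sqr p) =
  w ^+ dot x (p.1, Zp_mul p.1 p.1) * w ^+ dot x (p.2, Zp_mul p.2 p.2).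
Proof.
have modw k m : w ^+ (k * (m %% N)) = w ^+ (k * m).
  by rewrite -(prim_expr_mod wP) modnMmr (prim_expr_mod wP).
rewrite !prim_dotE /= !exprD !modw !mulnDr !exprD !modw.
by rewrite mulrACA.
Qed.

(** A geometric sum in [v = w ^+ k / w ^+ l], where [v ^+ N = 1] and [v = 1] only for [k = l]. *)
Lemma sum_prim_expr (k l : 'I_N) :
  \sum_(x < N) w ^+ (x * k) / w ^+ (x * l) = N%:R *+ (k == l).
Proof.
pose v := w ^+ k / w ^+ l.
have -> : \sum_(x < N) w ^+ (x * k) / w ^+ (x * l) = \sum_(x < N) v ^+ x.
  by apply: eq_bigr => x _; rewrite exprMn exprVn -!exprM ![(x * _)%N]mulnC.
have vN : v ^+ N = 1.
  rewrite exprMn exprVn -!exprM ![(_ * N)%N]mulnC !exprM.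
  by rewrite (prim_expr_order wP) !expr1n divr1.
have v1 : (v == 1) = (k == l).
  rewrite /v -(inj_eq (mulIf (expf_neq0 l w_neq0))) mul1r mulfVK ?expf_neq0 //.
  by rewrite (eq_prim_root_expr wP) !modn_small.
have [kl|kl] := eqVneq k l.
  move: v1; rewrite kl eqxx => /eqP ->.
  by under eq_bigr do rewrite expr1n; rewrite sumr_const card_ord.
have : (v - 1) * \sum_(x < N) v ^+ x = 0 by rewrite -subrX1 vN subrr.
by move/eqP; rewrite mulf_eq0 subr_eq0 v1 (negPf kl) => /eqP.
Qed.

Lemma sum_prim_dot (m n : 'I_N * 'I_N) :
  \sum_x w ^+ dot x m / w ^+ dot x n = N%:R ^+ 2 *+ (m == n).
Proof.
transitivity (\sum_(x : 'I_N * 'I_N) (w ^+ (x.1 * m.1) / w ^+ (x.1 * n.1)) *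
                     (w ^+ (x.2 * m.2) / w ^+ (x.2 * n.2))).
  by apply: eq_bigr => x _; rewrite !prim_dotE !exprD invfM mulrACA.
rewrite -(pair_big xpredT xpredT (fun x1 x2 : 'I_N =>
  (w ^+ (x1 * m.1) / w ^+ (x1 * n.1)) * (w ^+ (x2 * m.2) / w ^+ (x2 * n.2)))) /=.
rewrite -big_distrlr /= !sum_prim_expr; case: m n => [m1 m2] [n1 n2] /=.
by rewrite xpair_eqE; case: (m1 == n1); case: (m2 == n2); rewrite ?mulr0 ?mul0r.
Qed.

(** Expanding the square gives a double sum of which orthogonality keeps the diagonal; each diagonal
    term carries the number [N ^ 2] of points [x]. *)
Lemma parseval (b : 'I_N * 'I_N -> C) :
  \sum_x `|\sum_m b m * w ^+ dot x m| ^+ 2 = N%:R ^+ 2 * \sum_m `|b m| ^+ 2.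
Proof.
transitivity
  (\sum_m \sum_n b m * (b n)^*%R * \sum_x w ^+ dot x m / w ^+ dot x n).
  transitivity
    (\sum_x \sum_m \sum_n b m * (b n)^*%R * (w ^+ dot x m / w ^+ dot x n)).
    apply: eq_bigr => x _; rewrite normCK rmorph_sum /= big_distrlr /=.
    apply: eq_bigr => m _; apply: eq_bigr => n _.
    by rewrite rmorphM /= conj_prim_root mulrACA.
  rewrite exchange_big; apply: eq_bigr => m _ /=.
  by rewrite exchange_big; apply: eq_bigr => n _ /=; rewrite mulr_sumr.
rewrite mulr_sumr; apply: eq_bigr => m _.
under eq_bigr do rewrite sum_prim_dot.
rewrite (bigD1 m) //= big1 => [|n /negPf nm]; last by rewrite eq_sym nm mulr0.
by rewrite eqxx addr0 -normCK mulrC.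
Qed.

Hypothesis sqfN : squarefree N.

Lemma extension_L4 (a : 'I_N -> C) :
  \sum_x `|\sum_t a t * w ^+ dot x (t, Zp_mul t t)| ^+ 4
    <= N%:R ^+ 2 * 2 ^+ omega N * (\sum_t `|a t| ^+ 2) ^+ 2.
Proof.
(* These are the Fourier coefficients of the square of the extension, to which Parseval is
   applied. *)
pose b u := \sum_(p | sum_sqr p == u) a p.1 * a p.2.
have sqrE x : (\sum_t a t * w ^+ dot x (t, Zp_mul t t)) ^+ 2
    = \sum_u b u * w ^+ dot x u.
  rewrite expr2 big_distrlr pair_bigA /=.
  rewrite (partition_big sum_sqr xpredT) //=.
  apply: eq_bigr => u _; rewrite mulr_suml; apply: eq_bigr => p /eqP <-.
  by rewrite prim_dot_sum_sqr mulrACA.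
have -> : \sum_x `|\sum_t a t * w ^+ dot x (t, Zp_mul t t)| ^+ 4
    = N%:R ^+ 2 * \sum_u `|b u| ^+ 2.
  rewrite -parseval; apply: eq_bigr => x _.
  by rewrite -sqrE normrX -exprM.
rewrite -mulrA ler_wpM2l ?exprn_ge0 ?ler0n //.
have -> : (\sum_t `|a t| ^+ 2) ^+ 2
    = \sum_u \sum_(p | sum_sqr p == u) `|a p.1 * a p.2| ^+ 2.
  rewrite expr2 big_distrlr pair_bigA /=.
  rewrite (partition_big sum_sqr xpredT) //=.
  by apply: eq_bigr => u _; apply: eq_bigr => p _; rewrite normrM exprMn.
rewrite mulr_sumr; apply: ler_sum => u _.
(* The factor 1 makes Cauchy-Schwarz produce the cardinality of the fibre. *)
apply: (@le_trans _ _ ((\sum_(p | sum_sqr p == u) 1 * `|a p.1 * a p.2|) ^+ 2)).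
  rewrite lerXn2r ?nnegrE ?normr_ge0 //.
    by apply: sumr_ge0 => p _; rewrite mul1r.
  by under [leRHS]eq_bigr do rewrite mul1r; exact: ler_norm_sum.
apply: le_trans (cauchy_schwarz_sum _ _ _ _ _) _ => [p|p|].
- exact: real1.
- exact: normr_real.
apply: ler_wpM2r; first by apply: sumr_ge0 => p _; apply: exprn_ge0.
under eq_bigr do rewrite expr1n.
by rewrite sumr_const -natrX ler_nat card_sum_sqr_fibre.
Qed.

(* With [a] the cube root of [|f|], the 4/3-th powers of [|f|] become [a ^+ 4],
   so the inequality makes sense in [C]. *)
Lemma restriction_L43 (f a : 'I_N * 'I_N -> C) (F : 'I_N -> C) :
  (forall x, 0 <= a x) -> (forall x, `|f x| = a x ^+ 3) ->
  (forall t, F t = N%:R^-1 * \sum_x f x / w ^+ dot x (t, Zp_mul t t)) ->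
  (\sum_t `|F t| ^+ 2) ^+ 2
    <= N%:R ^- 2 * 2 ^+ omega N * (\sum_x a x ^+ 4) ^+ 3.
Proof.
move=> a_ge0 fE FE; set A := \sum_t _; set S := \sum_x _.
pose g x := \sum_t F t * w ^+ dot x (t, Zp_mul t t).
have A_ge0 : 0 <= A by apply: sumr_ge0 => t _; apply: exprn_ge0.
have S_ge0 : 0 <= S by apply: sumr_ge0 => x _; apply: exprn_ge0.
have NA : N%:R * A = \sum_x f x * (g x)^*%R.
  transitivity (\sum_t \sum_x f x / w ^+ dot x (t, Zp_mul t t) * (F t)^*%R).
    rewrite mulr_sumr; apply: eq_bigr => t _; rewrite normCK {1}FE !mulrA.
    by rewrite mulfV ?(prim_root_natf_neq0 wP) // mul1r mulr_suml.
  rewrite exchange_big; apply: eq_bigr => x _ /=.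
  rewrite rmorph_sum mulr_sumr; apply: eq_bigr => t _ /=.
  by rewrite rmorphM /= conj_prim_root mulrAC mulrA.
have duality : (N%:R * A) ^+ 4 <= S ^+ 3 * (N%:R ^+ 2 * 2 ^+ omega N * A ^+ 2).
  apply: (@le_trans _ _ ((\sum_x a x ^+ 3 * `|g x|) ^+ 4)).
    rewrite lerXn2r ?nnegrE ?[0 <= _ * A]mulr_ge0 ?ler0n //.
      by apply: sumr_ge0 => x _; rewrite mulr_ge0 ?exprn_ge0.
    rewrite -[leLHS]ger0_norm ?mulr_ge0 ?ler0n // NA.
    apply: le_trans (ler_norm_sum _ _ _) _; apply: ler_sum => x _.
    by rewrite normrM norm_conjC fE.
  apply: le_trans (hoelder43_sum _ _ _ _) _ => //.
  by rewrite ler_wpM2l ?exprn_ge0 // extension_L4.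
(* [duality] bounds a multiple of [A ^+ 4] by one of [A ^+ 2]; cancelling [A ^+ 2] requires [A] to
   be nonzero. *)
have [->|A_neq0] := eqVneq A 0.
  by rewrite expr0n /= !mulr_ge0 ?invr_ge0 ?exprn_ge0 ?ler0n.
have N_gt0' : 0 < N%:R :> C by rewrite ltr0n.
have A2_gt0 : 0 < A ^+ 2 by rewrite exprn_gt0 // lt_def A_neq0.
rewrite -(ler_pM2l (mulr_gt0 (exprn_gt0 4 N_gt0') A2_gt0)).
have -> : N%:R ^+ 4 * A ^+ 2 * A ^+ 2 = (N%:R * A) ^+ 4 by ring.
apply: le_trans duality _; rewrite le_eqVlt; apply/orP; left; apply/eqP.
by field; rewrite gt_eqF.
Qed.
End Characters.

(** * The complex exponential as a primitive root of unity *)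

Lemma normC_normc {R : realType} (z : R[i]) : `|z| = (normc z)%:C.
Proof. by case: z. Qed.

Lemma normc_ge0 {R : realType} (z : R[i]) : 0 <= normc z.
Proof. by case: z => ? ?; exact: sqrtr_ge0. Qed.

Lemma expiD {R : realType} (s t : R) : expi (s + t) = expi s * expi t.
Proof.
apply/eqP; rewrite eq_complex /= cosD sinD addrC.
by rewrite [X in _ && (X == _)]addrC !eqxx.
Qed.

Lemma expi0 {R : realType} : expi (0 : R) = 1.
Proof. by rewrite /expi cos0 sin0. Qed.

Lemma expiN {R : realType} (t : R) : expi (- t) = (expi t)^-1.
Proof.
have e : expi (- t) * expi t = 1 by rewrite -expiD addNr expi0.
have t0 : expi t != 0.
  by apply/eqP => t0; move/eqP: e; rewrite t0 mulr0 eq_sym oner_eq0.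
by rewrite -[LHS](mulfK t0) e mul1r.
Qed.

Lemma expiMn {R : realType} (t : R) (n : nat) : expi (t *+ n) = expi t ^+ n.
Proof. by elim: n => [|n IHn]; rewrite ?expi0 // mulrS expiD IHn exprS. Qed.

(** The real part is [1 - 2 sin(t/2)^2], and the sine is positive because [t / 2] lies strictly
    between 0 and [pi]. *)
Lemma expi_neq1 {R : realType} (t : R) : 0 < t < 2 * pi -> expi t != 1.
Proof.
move=> /andP[t_gt0 t_lt]; apply/eqP => /(congr1 (@complex.Re R)) /=.
have st : 0 < sin (t / 2) by apply: sin_gt0_pi; lra.
have -> : t = (t / 2) *+ 2 by rewrite mulr2n; field.
rewrite cos_mulr2n cos2sin2 => e.
have := exprn_gt0 2 st; lra.
Qed.

(** For an exponent [k.+1 < N] the angle lies strictly between 0 and [2 * pi]; for [k.+1 = N] it is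
    a full turn. *)
Lemma expi_prim_root {R : realType} {N : nat} : (0 < N)%N ->
  N.-primitive_root (expi (2 * pi / N%:R : R)).
Proof.
move=> N_gt0; apply/andP; split=> //; apply/forallP => k.
have N0 : (N%:R : R) != 0 by rewrite pnatr_eq0 -lt0n.
rewrite unity_rootE -expiMn -(mulr_natr _ k.+1); apply/eqP.
have [->|kN] := eqVneq k.+1 N.
  by apply/eqP; rewrite mulfVK // mulr_natl /expi cos2pi sin2pi.
apply/negbTE/expi_neq1.
have ltkN : (k.+1 < N)%N by rewrite ltn_neqAle kN ltn_ord.
rewrite mulr_gt0 ?divr_gt0 ?mulr_gt0 ?pi_gt0 ?ltr0n //=.
rewrite mulrAC ltr_pdivrMr ?ltr0n // ltr_pM2l ?mulr_gt0 ?pi_gt0 //.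
by rewrite ltr_nat.
Qed.

(** Brings the transform into the form that [restriction_L43] asks of [F]. *)
Lemma fourierE {R : realType} {N : nat} (f : 'I_N * 'I_N -> R[i]) m :
  fourier f m =
  N%:R^-1 * \sum_x f x / expi (2 * pi / N%:R : R) ^+ dot x m.
Proof.
congr (_ * _); apply: eq_bigr => x _; congr (_ * _).
rewrite -expiMn -expiN; congr (expi (- _)).
by rewrite -[RHS]mulr_natr [RHS]mulrAC.
Qed.

(** * Transfer to real norms and fractional powers *)

(** This is the fourth power of the desired inequality, multiplied by [N ^ 2], so that the outer
    exponents are integers. The embedding of [R] in [R[i]] reduces it to [restriction_L43]. *)
Lemma restriction_normc {R : realType} {N : nat} (f : 'I_N * 'I_N -> R[i]) :
  (0 < N)%N -> squarefree N ->
  (\sum_t normc (fourier f (t, Zp_mul t t)) ^+ 2) ^+ 2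
    <= N%:R ^- 2 * 2 ^+ omega N * (\sum_x normc (f x) `^ (4 / 3)) ^+ 3.
Proof.
move=> N_gt0 sqfN; rewrite -lecR.
pose a x : R[i] := (normc (f x) `^ (1 / 3))%:C.
have a_ge0 x : 0 <= a x by rewrite ler0c powR_ge0.
have aX x (k : nat) : a x ^+ k = (normc (f x) `^ (k%:R / 3))%:C.
  by rewrite -rmorphXn /= -powR_mulrn ?powR_ge0 // -powRrM mulrC mulrA mulr1.
have fE x : `|f x| = a x ^+ 3.
  by rewrite aX divff ?pnatr_eq0 // powRr1 ?normc_ge0 // normC_normc.
have := @restriction_L43 R[i] N _ (expi_prim_root N_gt0) sqfN f a _ a_ge0 fE
  (fun t => fourierE f _).
rewrite !(rmorphXn, rmorphM, rmorph_sum, fmorphV, rmorph_nat) /=.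
under eq_bigr do rewrite normC_normc -rmorphXn.
by under [X in _ <= _ * X ^+ 3]eq_bigr do rewrite aX.
Qed.

Theorem theorem1p1 (R : realType) (N : nat) (N_gt0 : (0 < N)%N)
    (sqfN : squarefree N) (f : 'I_N * 'I_N -> R[i]) :
  (#|parabola N|%:R^-1 *
     \sum_(m in parabola N) normc (fourier f m) ^+ 2) `^ (1 / 2)
  <= 2 `^ ((omega N)%:R / 4) * N%:R^-1 *
     (\sum_(x : 'I_N * 'I_N) normc (f x) `^ (4 / 3)) `^ (3 / 4).
Proof.
(* Injectivity gives the parabola [N] points and turns the sum over it into a sum over [t]. *)
have graph_inj : injective (fun t : 'I_N => (t, Zp_mul t t)) by move=> s t [].
have := restriction_normc f N_gt0 sqfN.
rewrite card_imset // card_ord big_imset /=; last by move=> s t _ _ /graph_inj.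
set A := \sum_t _; set S := \sum_x _ => A2_le.
have A_ge0 : 0 <= A by apply: sumr_ge0 => t _; apply/exprn_ge0/normc_ge0.
have S_ge0 : 0 <= S by apply: sumr_ge0 => x _; apply: powR_ge0.
have N_gt0R : 0 < N%:R :> R by rewrite ltr0n.
(* Every exponent is written over 4, so both sides become fourth roots and monotonicity of the root
   leaves an inequality between integer powers. *)
have powR4 (z : R) (k : nat) : 0 <= z -> z `^ (k%:R / 4) = (z ^+ k) `^ (4^-1).
  by move=> z_ge0; rewrite powRrM powR_mulrn.
have -> : 1 / 2 = 2%:R / 4 :> R by field.
have NE : N%:R^-1 = (N%:R^-1 ^+ 4) `^ (4^-1) :> R.
  by rewrite -powR4 ?divff ?pnatr_eq0 ?powRr1 ?invr_ge0 ?ler0n.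
rewrite !powR4 ?mulr_ge0 ?invr_ge0 ?ler0n // [in leRHS]NE.
rewrite -!powRM ?mulr_ge0 ?exprn_ge0 ?invr_ge0 ?ler0n //.
rewrite ge0_ler_powR ?nnegrE ?mulr_ge0 ?exprn_ge0 ?mulr_ge0 ?invr_ge0 ?ler0n //.
(* The outer [N%:R^-1 ^+ 2] is the square of the averaging factor over the parabola. *)
apply: (@le_trans _ _ (N%:R^-1 ^+ 2 * (N%:R ^- 2 * 2 ^+ omega N * S ^+ 3))).
  by rewrite exprMn ler_wpM2l ?exprn_ge0 ?invr_ge0 ?ler0n.
rewrite le_eqVlt; apply/orP; left; apply/eqP.
by field; rewrite gt_eqF.
Qed.
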